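(* (Freiheitssatz) Let $Br(x_1,x_2,\dots,x_M)$ be the free brace algebra over a field $F$ of characteristic $0$ in the variables $x_1,x_2,\dots,x_M$. If $f\in Br(x_1,x_2,\dots,x_M)$ and $f\notin Br(x_1,x_2,\dots,x_{M-1})$, then $Id(f)\cap Br(x_1,x_2,\dots,x_{M-1})=0$.
   Context: A brace algebra over $F$ is an $F$-vector space $A$ with a family of multilinear operations $A^{\otimes n}\to A$, $a_n\otimes\dots\otimes a_1\mapsto\langle a_n,\dots,a_2;a_1\rangle$, for all $n\ge 2$ (with the convention $\langle a\rangle=a$), such that for all $a_1,\dots,a_m,b_1,\dots,b_n,c\in A$: $$\langle a_m,\dots,a_1;\langle b_n,\dots,b_1;c\rangle\rangle=\sum\langle V_{2n},\langle V_{2n-1};b_n\rangle,\dots,V_4,\langle V_3;b_2\rangle,V_2,\langle V_1;b_1\rangle,V_0;c\rangle,$$ the sum running over all partitions of the ordered set $\{a_m,\dots,a_1\}$ into (possibly empty) consecutive intervals $V_{2n}\sqcup\dots\sqcup V_0$ (in this order). $Br(X)=Br(x_1,\dots,x_M)$ denotes the free brace algebra over $F$ generated by $X=\{x_1,\dots,x_M\}$. Concretely, normal brace words on $X$ are defined recursively: each letter $x\in X$ is a normal brace word, and if $x\in X$ and $u_1,\dots,u_n$ ($n\ge1$) are normal brace words, then $\langle u_n,\dots,u_1;x\rangle$ is a normal brace word. The set of normal brace words is an $F$-basis of $Br(X)$, and the operations are the multilinear ones determined recursively by: $\langle v_m,\dots,v_1;x\rangle$ is the normal brace word itself for $x\in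 X$, and, for $w=\langle u_n,\dots,u_1;x\rangle$, $\langle v_m,\dots,v_1;w\rangle=\sum\langle V_{2n},\langle V_{2n-1};u_n\rangle,\dots,V_2,\langle V_1;u_1\rangle,V_0;x\rangle$, the sum over partitions of $\{v_m,\dots,v_1\}$ into possibly empty consecutive intervals $V_{2n}\sqcup\dots\sqcup V_0$. $Br(x_1,\dots,x_{M-1})$ is regarded as the subalgebra of $Br(x_1,\dots,x_M)$ generated by $x_1,\dots,x_{M-1}$. $Id(f)$ is the ideal of $Br(x_1,\dots,x_M)$ generated by $f$, where an ideal is a subspace $I$ such that $\langle a_n,\dots,a_2;a_1\rangle\in I$ whenever some $a_i\in I$. *)

(* Defs.v *)
From HB Require Import structures.
From mathcomp Require Import all_boot all_order all_algebra.
From mathcomp Require Import finmap.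
From mathcomp.multinomials Require Import monalg.

Set Implicit Arguments.
Unset Strict Implicit.
Unset Printing Implicit Defensive.

Import GRing.Theory.
Local Open Scope ring_scope.

(* [BWord x [:: u_n; ..; u_1]] is the normal brace word <u_n, .., u_1; x>;
   the letter x itself is [BWord x [::]].  Sequences of arguments are kept
   in the order in which they are written inside the brackets. *)
Inductive bword (X : Type) : Type := BWord of X & seq (bword X).

Section BwordChoice.
Variable X : choiceType.

Fixpoint bword_encode (w : bword X) : GenTree.tree X :=
  let: BWord x us := w in
  GenTree.Node 0 (GenTree.Leaf x :: map bword_encode us).

Fixpoint bword_decode (t : GenTree.tree X) : option (bword X) :=
  match t with
  | GenTree.Node _ (GenTree.Leaf x :: ts) =>
      Some (BWord x (pmap bword_decode ts))
  | _ => None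
  end.

Fixpoint bword_encodeK (w : bword X) :
  bword_decode (bword_encode w) = Some w.
Proof.
case: w => x us /=; congr (Some (BWord x _)).
by elim: us => //= u us IHus; rewrite bword_encodeK /= IHus.
Qed.

HB.instance Definition _ :=
  Choice.copy (bword X) (pcan_type (bword_encodeK : pcancel _ _)).

End BwordChoice.

Definition cuts (T : Type) (s : seq T) : seq (seq T * seq T) :=
  [seq (take i s, drop i s) | i <- iota 0 (size s).+1].

(* [insert g us vs] lists the sequences
     V_{2n}, g(V_{2n-1}; u_n), .., V_2, g(V_1; u_1), V_0
   over all partitions of vs into consecutive intervals: the first cut splits
   off V_{2n}, the second one V_{2n-1}, and so on, and the last interval V_0 is
   what remains.  Here g(V; u) is itself a list of words, standing for their
   sum, and the list of sequences is expanded accordingly. *)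
Section Insert.
Variables (T : Type) (g : T -> seq T -> seq T).

Fixpoint insert (us vs : seq T) : seq (seq T) :=
  if us is u :: us' then
    flatten [seq flatten [seq [seq p.1 ++ t :: r
                              | t <- g u q.1, r <- insert us' q.2]
                         | q <- cuts p.2]
            | p <- cuts vs]
  else [:: vs].

End Insert.

(* All coefficients in the recursive formula for <v_m, .., v_1; w> are 1, so
   the value of the operation on normal brace words is a sum of normal brace
   words; [graft w vs] lists its terms, with multiplicity. *)
Fixpoint graft (X : Type) (w : bword X) (vs : seq (bword X)) {struct w} :
    seq (bword X) :=
  let: BWord x us := w in map (BWord x) (insert (@graft X) us vs).

Notation Br F X := {malg F[bword X]}.

Section FreeBrace.
Variables (F : fieldType) (X : choiceType).

Local Notation Br := (Br F X).

Definition bmono (w : bword X) : Br := @mkmalgU _ F w 1.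

Definition bletter (x : X) : Br := bmono (BWord x [::]).

(* The multilinear extension to Br of a function [k] of a sequence of words. *)
Fixpoint multilin (k : seq (bword X) -> Br) (s : seq Br) : Br :=
  if s is a :: s' then
    \sum_(v <- msupp a) a@_v *: multilin (fun vs => k (v :: vs)) s'
  else k [::].

(* [brace [:: a_n; ..; a_2] a_1] is <a_n, .., a_2; a_1>. *)
Definition brace (s : seq Br) (a : Br) : Br :=
  \sum_(w <- msupp a)
     a@_w *: multilin (fun vs => \sum_(t <- graft w vs) bmono t) s.

Definition subspace (S : Br -> Prop) : Prop :=
  S 0 /\ (forall (c : F) a b, S a -> S b -> S (c *: a + b)).

(* In the next two definitions the empty sequence of arguments is harmless:
   <a> = a, see [brace0] below. *)
Definition brace_subalgebra (S : Br -> Prop) : Prop :=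
  subspace S /\
  (forall (s : seq Br) a, (forall b, b \in a :: s -> S b) -> S (brace s a)).

Definition brace_ideal (I : Br -> Prop) : Prop :=
  subspace I /\
  (forall (s : seq Br) a, (exists2 b, b \in a :: s & I b) -> I (brace s a)).

Definition subalgebra_gen (G : Br -> Prop) (a : Br) : Prop :=
  forall S, brace_subalgebra S -> (forall g, G g -> S g) -> S a.

Definition Id (f a : Br) : Prop :=
  forall I, brace_ideal I -> I f -> I a.

Lemma graft0 (w : bword X) : graft w [::] = [:: w].
Proof.
move: w; fix IH 1; case=> x us /=.
suff -> : insert (@graft X) us [::] = [:: us] by [].
by elim: us => //= u us IHus; rewrite IH IHus.
Qed.

Lemma brace0 (a : Br) : brace [::] a = a.
Proof.
rewrite /brace [RHS](monalgE a); apply: eq_bigr => w _ /=.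
rewrite graft0 big_seq1; move: (a@_w) => c {a}; apply/malgP => v.
rewrite mcoeffZ [X in _ * X]mcoeffU [RHS]mcoeffU.
by rewrite mulrnAr mulr1.
Qed.

End FreeBrace.

(* Main.v *)
Require Import Defs.
From HB Require Import structures.
From mathcomp Require Import all_boot all_order all_algebra.
From mathcomp Require Import finmap zify.
From mathcomp.multinomials Require Import monalg.
From Stdlib Require Import ClassicalEpsilon.

(** Write z for the last letter and <c_k, .., c_1; f> for the brace.  Call the
    elements e_c = <c_k, .., c_1; f>, with c a sequence of words, the relators.

    Forgetting the braces, Br is the absolutely free algebra with one n-ary
    operation u_n, .., u_1 |-> <u_n, .., u_1; x> for each letter x and each n.
    Because of the brace identity (sum_graftA), the ideal of this absolutely
    free structure generated by the relators is already a brace ideal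
    (graft_ideal_brace_ideal), so it contains Id(f).  It remains to see that it
    meets the span of the z-free words trivially, and for this the relators are
    shown to form a Groebner basis without overlaps.

    Order words by z-degree, then number of letters, then number of root
    arguments, then root letter, then lexicographically by the arguments.  If
    f involves z, its leading word T = <u_n, .., u_1; x> contains z, because
    the z-degree is compared first.  Grafting c onto a word adds the degrees
    of c, so that the largest words of <c; f> come from the terms of f with the
    degrees of T; among these, the order favours attaching every c_i at the
    root of T.  The leading word of e_c is thus <v; x> for the largest shuffle v
    of c and u (lead_weave).  Its coefficient is that of T in f times a positive
    integer, nonzero in characteristic 0 (relator_lead_neq0), and it determines
    c since, u being fixed, the largest shuffle is strictly increasing in c
    (lead_inj).

    A word is normal when no subword is the leading word of a relator.  All
    leading words have at least as many letters as T, and a proper subword of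
    the leading word of e_c is either a proper subword of T, hence normal, or a
    subword of some c_i: for normal c there is nothing to overlap with.  Rewriting leading words
    therefore defines a linear normal form nf by well-founded recursion.  By
    construction its kernel is an ideal of the absolutely free structure and
    contains e_c for normal c; replacing the c_i by their normal forms one at a
    time gives all e_c (relator_kernel).  Hence Id(f) lies in the kernel.
    Leading words contain z, so z-free words are normal and nf fixes them: a
    z-free element of Id(f) vanishes. *)

Set Implicit Arguments.
Unset Strict Implicit.
Unset Printing Implicit Defensive.

Import GRing.Theory.
Local Open Scope ring_scope.

(** The automatic induction principle ignores the words nested in the
    sequence of arguments. *)
Lemma bword_ind_mem (X : choiceType) (P : bword X -> Prop) :
  (forall x us, {in us, forall u, P u} -> P (BWord x us)) -> forall w, P w.
Proof.
move=> IH; fix rec 1; case=> x us; apply: IH.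
elim: us => [|u us IHus] v; first by clear rec.
by have Pu := rec u; rewrite inE => /predU1P[->|/IHus].
Qed.

(** * Sums over the cuts of a sequence *)

Section Cuts.
Variables (T : Type) (V : nmodType).

Lemma sum_cuts_nil (F : seq T -> seq T -> V) :
  \sum_(p <- cuts [::]) F p.1 p.2 = F [::] [::].
Proof. by rewrite /cuts /= big_seq1. Qed.

Lemma cuts_cons (v : T) s :
  cuts (v :: s) = ([::], v :: s) :: [seq (v :: p.1, p.2) | p <- cuts s].
Proof.
have E n : iota 0 n.+1 = 0%N :: map S (iota 0 n) by rewrite -(iotaDl 1 0).
by rewrite /cuts -[size (v :: s)]/(size s).+1 [in LHS]E map_cons -!map_comp.
Qed.

Lemma sum_cuts_cons (v : T) s (F : seq T -> seq T -> V) :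
  \sum_(p <- cuts (v :: s)) F p.1 p.2 =
  F [::] (v :: s) + \sum_(p <- cuts s) F (v :: p.1) p.2.
Proof. by rewrite cuts_cons big_cons big_map. Qed.

Lemma sum_cuts_cat_cons (s1 s2 : seq T) (v : T) (F : seq T -> seq T -> V) :
  \sum_(p <- cuts (s1 ++ v :: s2)) F p.1 p.2 =
  \sum_(p <- cuts s1) F p.1 (p.2 ++ v :: s2) +
  \sum_(p <- cuts s2) F (s1 ++ v :: p.1) p.2.
Proof.
elim: s1 F => [|a s1 IHs] F /=.
  by rewrite sum_cuts_cons (sum_cuts_nil (fun a b => F a (b ++ v :: s2))).
rewrite sum_cuts_cons (IHs (fun a1 a2 => F (a :: a1) a2)) addrA.
by rewrite (sum_cuts_cons _ _ (fun a b => F a (b ++ v :: s2))).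
Qed.

(** Coassociativity of cutting: both sides run over the ways to split s into
    three consecutive intervals. *)
Lemma sum_cutsA (s : seq T) (F : seq T -> seq T -> seq T -> V) :
  \sum_(p <- cuts s) \sum_(q <- cuts p.1) F q.1 q.2 p.2 =
  \sum_(p <- cuts s) \sum_(q <- cuts p.2) F p.1 q.1 q.2.
Proof.
elim: s F => [|v s IHs] F.
  rewrite (sum_cuts_nil (fun a b => \sum_(q <- cuts a) F q.1 q.2 b)).
  rewrite (sum_cuts_nil (fun a b => \sum_(q <- cuts b) F a q.1 q.2)).
  by rewrite !sum_cuts_nil (sum_cuts_nil (fun a b => F a b [::])).
rewrite (sum_cuts_cons _ _ (fun a b => \sum_(q <- cuts a) F q.1 q.2 b)).
rewrite (sum_cuts_cons _ _ (fun a b => \sum_(q <- cuts b) F a q.1 q.2)).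
rewrite (sum_cuts_nil (fun a b => F a b (v :: s))).
rewrite (sum_cuts_cons _ _ (fun a b => F [::] a b)) -addrA; congr (_ + _).
rewrite -(IHs (fun a => F (v :: a))) -big_split /=; apply: eq_bigr => p _.
by rewrite (sum_cuts_cons _ _ (fun a b => F a b p.2)).
Qed.

(** The four-interval form, with the brackets placed as they appear when one
    insertion is expanded inside another. *)
Lemma sum_cutsA4 (s : seq T) (F : seq T -> seq T -> seq T -> seq T -> V) :
  \sum_(p <- cuts s) \sum_(q <- cuts p.1) \sum_(r <- cuts q.2)
    F q.1 r.1 r.2 p.2 =
  \sum_(p <- cuts s) \sum_(q <- cuts p.2) \sum_(r <- cuts q.2)
    F p.1 q.1 r.1 r.2.
Proof.
rewrite (sum_cutsA _ (fun a b c => \sum_(r <- cuts b) F a r.1 r.2 c)).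
by apply: eq_bigr => p _; rewrite (sum_cutsA _ (F p.1)).
Qed.

Lemma sum_insert_cons g (u : T) us vs (F : seq T -> V) :
  \sum_(t <- insert g (u :: us) vs) F t =
  \sum_(p <- cuts vs) \sum_(q <- cuts p.2)
    \sum_(t <- g u q.1) \sum_(r <- insert g us q.2) F (p.1 ++ t :: r).
Proof.
rewrite [insert _ _ _]/insert -/(insert g).
rewrite big_flatten big_map; apply: eq_bigr => p _.
rewrite big_flatten big_map; apply: eq_bigr => q _.
by rewrite big_allpairs_dep.
Qed.

(** Inserting in a sequence with a marked entry b: the interval absorbed by b
    separates what is inserted to its left from what is inserted to its
    right. *)
Lemma sum_insert_cat_cons g (a c : seq T) b vs (F : seq T -> V) :
  \sum_(t <- insert g (a ++ b :: c) vs) F t =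
  \sum_(p <- cuts vs) \sum_(q <- cuts p.2) \sum_(s <- insert g a p.1)
    \sum_(t <- g b q.1) \sum_(r <- insert g c q.2) F (s ++ t :: r).
Proof.
elim: a vs F => [|u a IHa] vs F; rewrite sum_insert_cons.
  by apply: eq_bigr => p _; apply: eq_bigr => q _; rewrite big_seq1.
pose K v1 v2 v3 v4 := \sum_(q <- cuts v4) \sum_(s <- g u v2)
  \sum_(s' <- insert g a v3) \sum_(t <- g b q.1) \sum_(r <- insert g c q.2)
    F (v1 ++ s :: s' ++ t :: r).
transitivity (\sum_(p <- cuts vs) \sum_(q <- cuts p.2) \sum_(r <- cuts q.2)
  K p.1 q.1 r.1 r.2).
  apply: eq_bigr => p _; apply: eq_bigr => q _.
  under eq_bigr => t _ do rewrite (IHa _ (fun r => F (p.1 ++ t :: r))).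
  rewrite exchange_big; apply: eq_bigr => r _.
  by rewrite exchange_big.
rewrite -sum_cutsA4; apply: eq_bigr => p _.
under [RHS]eq_bigr => q _ do rewrite sum_insert_cons.
rewrite [RHS]exchange_big; apply: eq_bigr => r _.
rewrite [RHS]exchange_big; apply: eq_bigr => r' _.
rewrite /K; apply: eq_bigr => q _; apply: eq_bigr => s _.
by apply: eq_bigr => s' _; apply: eq_bigr => t _; apply: eq_bigr => y _;
  rewrite -catA.
Qed.

(** Insertion is compatible with cutting, like the product of a bialgebra with
    the deconcatenation coproduct.  A cut of a term V_2n, g_n, .., g_1, V_0
    falls inside some V_2i; the two halves are terms of the insertions for the
    corresponding cuts of us and vs. *)
Lemma sum_cuts_insert g (us vs : seq T) (F : seq T -> seq T -> V) :
  \sum_(t <- insert g us vs) \sum_(p <- cuts t) F p.1 p.2 =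
  \sum_(p <- cuts us) \sum_(q <- cuts vs)
    \sum_(t <- insert g p.1 q.1) \sum_(r <- insert g p.2 q.2) F t r.
Proof.
elim: us vs F => [|u us IHus] vs F.
  rewrite big_seq1 (sum_cuts_nil (fun a b => \sum_(q <- cuts vs)
    \sum_(t <- insert g a q.1) \sum_(r <- insert g b q.2) F t r)).
  by apply: eq_bigr => q _; rewrite !big_seq1.
rewrite sum_insert_cons (sum_cuts_cons _ _ (fun a b => \sum_(q <- cuts vs)
  \sum_(t <- insert g a q.1) \sum_(r <- insert g b q.2) F t r)).
(* K1 sums the terms cut before the value at u, K2 those cut after it. *)
pose K1 (v1 v2 v3 : seq T) := \sum_(q <- cuts v3) \sum_(t <- g u q.1)
  \sum_(r <- insert g us q.2) F v1 (v2 ++ t :: r).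
pose K2 v1 v2 v3 v4 := \sum_(p <- cuts us) \sum_(t <- g u v2)
  \sum_(t1 <- insert g p.1 v3) \sum_(t2 <- insert g p.2 v4)
     F (v1 ++ t :: t1) t2.
transitivity (\sum_(p <- cuts vs) \sum_(q <- cuts p.1) K1 q.1 q.2 p.2 +
  \sum_(p <- cuts vs) \sum_(q <- cuts p.2) \sum_(r <- cuts q.2)
   K2 p.1 q.1 r.1 r.2); last congr (_ + _).
- rewrite -big_split; apply: eq_bigr => p _ /=.
  rewrite /K1 [X in _ = X + _]exchange_big -big_split.
  apply: eq_bigr => q _ /=.
  transitivity (\sum_(t <- g u q.1)
    (\sum_(r <- insert g us q.2) \sum_(c <- cuts p.1) F c.1 (c.2 ++ t :: r) +
     \sum_(r <- insert g us q.2) \sum_(c <- cuts r) F (p.1 ++ t :: c.1) c.2)).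
    apply: eq_bigr => t _; rewrite -big_split; apply: eq_bigr => r _.
    by rewrite sum_cuts_cat_cons.
  rewrite big_split; congr (_ + _).
    rewrite [RHS]exchange_big; apply: eq_bigr => t _.
    by rewrite exchange_big.
  under eq_bigr => t _ do rewrite (IHus _ (fun a b => F (p.1 ++ t :: a) b)).
  rewrite exchange_big; under eq_bigr => c _ do rewrite exchange_big.
  by rewrite exchange_big.
- rewrite sum_cutsA; apply: eq_bigr => p _.
  by rewrite big_seq1 sum_insert_cons.
- rewrite -sum_cutsA4 [RHS]exchange_big; apply: eq_bigr => p _ /=.
  under [RHS]eq_bigr => c _ do rewrite sum_insert_cons.
  rewrite [RHS]exchange_big; apply: eq_bigr => q _.
  by rewrite [RHS]exchange_big; apply: eq_bigr.
Qed.

End Cuts.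

(** * The brace identity *)

Section BraceIdentity.
Variables (X : choiceType) (V : nmodType).
Implicit Types (u v w : bword X) (us vs ws : seq (bword X)).

Lemma sum_graft_BWord x us vs (F : bword X -> V) :
  \sum_(t <- graft (BWord x us) vs) F t =
  \sum_(r <- insert (@graft X) us vs) F (BWord x r).
Proof. by rewrite /= big_map. Qed.

(** The brace identity for words.  By induction on w it reduces to the
    associativity of insertion, which follows by comparing the intervals that
    the first argument of w absorbs on both sides: one side is expanded by
    sum_insert_cat_cons, the other by two uses of sum_cuts_insert. *)
Lemma sum_graftA w us vs (F : bword X -> V) :
  \sum_(t <- graft w us) \sum_(s <- graft t vs) F s =
  \sum_(r <- insert (@graft X) us vs) \sum_(s <- graft w r) F s.
Proof.
elim/bword_ind_mem: w us vs F => x ws IH us vs F; rewrite sum_graft_BWord.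
under eq_bigr => t _ do rewrite sum_graft_BWord.
under [RHS]eq_bigr => t _ do rewrite sum_graft_BWord.
suff insertA (G : seq (bword X) -> V) :
  \sum_(t <- insert (@graft X) ws us) \sum_(s <- insert (@graft X) t vs) G s =
  \sum_(r <- insert (@graft X) us vs) \sum_(s <- insert (@graft X) ws r) G s.
  exact: (insertA (fun r => F (BWord x r))).
elim: ws IH us vs G {F} => [|w ws IHws] IH us vs F.
  by rewrite big_seq1; apply: eq_bigr => r _; rewrite big_seq1.
have IHw := IH _ (mem_head w ws).
have {}IHws := IHws (fun u u_ws => IH u (mem_behead (s := w :: ws) u_ws)).
(* p, q cut us and P, Q cut vs: the first components of p and P stay to the
   left of the value at w, those of q and Q are absorbed by w. *)
pose K (p q P Q : seq (bword X) * seq (bword X)) :=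
  \sum_(s1 <- insert (@graft X) p.1 P.1)
  \sum_(y <- insert (@graft X) q.1 Q.1) \sum_(s2 <- graft w y)
  \sum_(z <- insert (@graft X) q.2 Q.2) \sum_(s3 <- insert (@graft X) ws z)
    F (s1 ++ s2 :: s3).
transitivity (\sum_(p <- cuts us) \sum_(P <- cuts vs)
  \sum_(q <- cuts p.2) \sum_(Q <- cuts P.2) K p q P Q).
  rewrite sum_insert_cons; apply: eq_bigr => p _.
  rewrite [RHS]exchange_big; apply: eq_bigr => q _.
  have split t r := sum_insert_cat_cons (@graft X) p.1 r t vs F.
  rewrite (eq_bigr _ (fun t _ => eq_bigr _ (fun r _ => split t r))).
  under eq_bigr => t _ do rewrite exchange_big.
  rewrite exchange_big; apply: eq_bigr => P _ /=.
  under eq_bigr => t _ do rewrite exchange_big.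
  rewrite exchange_big; apply: eq_bigr => Q _ /=.
  under eq_bigr => t _ do rewrite exchange_big.
  rewrite exchange_big; apply: eq_bigr => s1 _ /=.
  under eq_bigr => t _ do rewrite exchange_big.
  rewrite /= (IHw _ _ (fun s2 => \sum_(r <- insert (@graft X) ws q.2)
    \sum_(s3 <- insert (@graft X) r Q.2) F (s1 ++ s2 :: s3))).
  apply: eq_bigr => y _; apply: eq_bigr => s2 _.
  exact: (IHws _ _ (fun s3 => F (s1 ++ s2 :: s3))).
under [RHS]eq_bigr => r _ do rewrite sum_insert_cons.
rewrite (sum_cuts_insert _ us vs (fun a b => \sum_(q <- cuts b)
  \sum_(t <- graft w q.1) \sum_(r <- insert (@graft X) ws q.2)
   F (a ++ t :: r))).
apply: eq_bigr => p _; apply: eq_bigr => P _; rewrite /K.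
transitivity (\sum_(s1 <- insert (@graft X) p.1 P.1)
  \sum_(q <- cuts p.2) \sum_(Q <- cuts P.2)
  \sum_(y <- insert (@graft X) q.1 Q.1) \sum_(s2 <- graft w y)
  \sum_(z <- insert (@graft X) q.2 Q.2) \sum_(s3 <- insert (@graft X) ws z)
    F (s1 ++ s2 :: s3)).
  by rewrite [RHS]exchange_big; apply: eq_bigr => q _; rewrite exchange_big.
apply: eq_bigr => s1 _.
rewrite (sum_cuts_insert _ _ _ (fun a b => \sum_(t <- graft w a)
  \sum_(r <- insert (@graft X) ws b) F (s1 ++ t :: r))).
apply: eq_bigr => q _; apply: eq_bigr => Q _; apply: eq_bigr => y _.
by rewrite exchange_big.
Qed.

End BraceIdentity.

(** * Linear and multilinear extension *)

Section Lin.
Variables (F : fieldType) (K : choiceType) (V : lmodType F).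
Implicit Types (a b : {malg F[K]}) (h : K -> V).

(** The linear extension to the free module of a function on its basis. *)
Definition lin h a : V := \sum_(w <- msupp a) a@_w *: h w.

Lemma linEw h a (d : {fset K}) : (msupp a `<=` d)%fset ->
  lin h a = \sum_(w <- d) a@_w *: h w.
Proof.
move=> sad; apply: big_fset_incl => // w _ /mcoeff_outdom ->.
by rewrite scale0r.
Qed.

Fact lin_is_linear h : linear (lin h).
Proof.
move=> c a b; pose d := (msupp a `|` msupp b)%fset.
rewrite (@linEw _ a d) ?fsubsetUl // (@linEw _ b d) ?fsubsetUr //.
rewrite (@linEw _ _ d).
  rewrite scaler_sumr -big_split; apply: eq_bigr => w _ /=.
  by rewrite mcoeffD mcoeffZ scalerDl scalerA.
apply: (fsubset_trans (msuppD_le _ _)).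
by apply: fsetSU; apply: msuppZ_le.
Qed.

HB.instance Definition _ h :=
  GRing.isLinear.Build F {malg F[K]} V *:%R (lin h) (lin_is_linear h).

Lemma eq_lin h1 h2 a : {in msupp a, h1 =1 h2} -> lin h1 a = lin h2 a.
Proof.
by move=> eqh; apply: eq_big_seq => w /eqh ->.
Qed.

Lemma linU h w : lin h (mkmalgU w 1) = h w.
Proof.
by rewrite (linEw _ msuppU_le) big_seq_fset1 mcoeffUU scale1r.
Qed.

Lemma lin_sum (I : Type) (r : seq I) (h : I -> K -> V) a :
  lin (fun w => \sum_(i <- r) h i w) a = \sum_(i <- r) lin (h i) a.
Proof. by rewrite exchange_big; apply: eq_bigr => w _; rewrite scaler_sumr. Qed.

End Lin.

Lemma lin_exchange (F : fieldType) (K L : choiceType) (V : lmodType F)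
    (h : K -> L -> V) (a : {malg F[K]}) (b : {malg F[L]}) :
  lin (fun v => lin (h v) b) a = lin (fun w => lin (h^~ w) a) b.
Proof.
rewrite [RHS]/lin; under [RHS]eq_bigr do rewrite scaler_sumr.
rewrite [RHS]exchange_big; apply: eq_bigr => v _ /=; rewrite scaler_sumr.
by apply: eq_bigr => w _; rewrite !scalerA mulrC.
Qed.

Lemma linear_lin (F : fieldType) (K : choiceType) (V W : lmodType F)
    (g : {linear V -> W}) (h : K -> V) (a : {malg F[K]}) :
  g (lin h a) = lin (g \o h) a.
Proof. by rewrite linear_sum; apply: eq_bigr => w _; rewrite linearZ. Qed.

Section Multilin.
Variables (F : fieldType) (X : choiceType).
Local Notation Br := (Br F X).
Local Notation bm := (@bmono F X).
Implicit Types (a b : Br) (s : seq Br) (k : seq (bword X) -> Br).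

Lemma lin_bmono a : lin bm a = a.
Proof.
rewrite [RHS]monalgE; apply: eq_bigr => w _ /=.
move: (a@_w) => c; apply/malgP => v.
by rewrite mcoeffZ [X in _ * X]mcoeffU [RHS]mcoeffU mulrnAr mulr1.
Qed.

Lemma multilin_cons k a s :
  multilin k (a :: s) = lin (fun v => multilin (fun vs => k (v :: vs)) s) a.
Proof. by []. Qed.

Lemma eq_multilin k1 k2 s :
  (forall vs, all2 (fun v a => v \in msupp a) vs s -> k1 vs = k2 vs) ->
  multilin k1 s = multilin k2 s.
Proof.
elim: s k1 k2 => [|a s IHs] k1 k2 eqk; first exact: eqk.
by apply: eq_lin => v av; apply: IHs => vs svs; apply: eqk; rewrite /= av.
Qed.

(** Multilinearity in one argument. *)
Lemma multilin_slot k s1 s2 h a :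
  lin (fun v => multilin k (s1 ++ h v :: s2)) a =
  multilin k (s1 ++ lin h a :: s2).
Proof.
elim: s1 k => [|b s1 IHs] k; first by rewrite multilin_cons linear_lin.
rewrite cat_cons multilin_cons [LHS]lin_exchange.
by apply: eq_lin => w _; apply: IHs.
Qed.

Lemma multilin_bmono k us : multilin k (map bm us) = k us.
Proof. by elim: us k => [|u us IHus] k //; rewrite multilin_cons linU IHus. Qed.

Lemma multilin_linC (h : bword X -> seq (bword X) -> Br) s a :
  lin (fun v => multilin (h v) s) a = multilin (fun vs => lin (h^~ vs) a) s.
Proof.
elim: s h => [|b s IHs] h; first exact: erefl.
rewrite [RHS]multilin_cons [LHS](lin_exchange (fun v w => _)).
by apply: eq_lin => w _; apply: IHs.
Qed.

Variable S : Br -> Prop.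
Hypothesis subS : subspace S.

Lemma subspace0 : S 0. Proof. by case: subS. Qed.

Lemma subspaceD a b : S a -> S b -> S (a + b).
Proof. by move=> Sa Sb; rewrite -[a]scale1r; apply: subS.2. Qed.

Lemma subspaceZ c a : S a -> S (c *: a).
Proof.
by move=> Sa; rewrite -[_ *: _]addr0; apply: subS.2 => //; apply: subspace0.
Qed.

Lemma subspace_sum (I : eqType) (r : seq I) (h : I -> Br) :
  {in r, forall i, S (h i)} -> S (\sum_(i <- r) h i).
Proof.
move=> Sh; rewrite big_seq; apply: (big_ind S) => //.
  exact: subspace0.
exact: subspaceD.
Qed.

Lemma subspace_lin (K : choiceType) (h : K -> Br) (a : {malg F[K]}) :
  {in msupp a, forall w, S (h w)} -> S (lin h a).
Proof.
move=> Sh; apply: subspace_sum => w aw; apply: subspaceZ; exact: Sh.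
Qed.

Lemma subspace_multilin k s :
  (forall vs, all2 (fun v a => v \in msupp a) vs s -> S (k vs)) ->
  S (multilin k s).
Proof.
elim: s k => [|a s IHs] k Sk; first exact: Sk.
by apply: subspace_lin => v av; apply: IHs => vs svs; apply: Sk; rewrite /= av.
Qed.

(** The form used to show that a subspace absorbs braces having one argument
    in it: the other arguments may be taken to be words. *)
Lemma subspace_multilin_slot k s1 b s2 :
  (forall p q, S (lin (fun v => k (p ++ v :: q)) b)) ->
  S (multilin k (s1 ++ b :: s2)).
Proof.
elim: s1 k => [|a s1 IHs] k Sk.
  rewrite multilin_cons (multilin_linC (fun v vs => k (v :: vs))).
  by apply: subspace_multilin => vs _; apply: (Sk [::]).
rewrite cat_cons; apply: subspace_lin => v _; apply: IHs => p q.
exact: (Sk (v :: p)).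
Qed.

End Multilin.

(** * Brace ideals and ideals for the tree-building operations *)

Section Ideals.
Variables (F : fieldType) (X : choiceType).
Local Notation Br := (Br F X).
Local Notation bm := (@bmono F X).
Implicit Types (a b f : Br) (S : Br -> Prop) (w : bword X)
  (p q us vs : seq (bword X)).

(** The operation <vs; w> on words, as an element of the algebra. *)
Definition graftsum w vs : Br := \sum_(t <- graft w vs) bm t.

(** The operation <p, _, q; x> of the absolutely free structure, in which
    arguments are attached to a letter and nothing is grafted further. *)
Definition plug x p q a : Br := lin (fun v => bm (BWord x (p ++ v :: q))) a.

Definition plug_closed S := forall x p q a, S a -> S (plug x p q a).

Lemma graftsum0 w : graftsum w [::] = bm w.
Proof. by rewrite /graftsum graft0 big_seq1. Qed.

Lemma plugU x p q v : plug x p q (bm v) = bm (BWord x (p ++ v :: q)).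
Proof. by rewrite /plug linU. Qed.

Lemma plug_sum x p q (r : seq (bword X)) :
  plug x p q (\sum_(t <- r) bm t) = \sum_(t <- r) bm (BWord x (p ++ t :: q)).
Proof.
rewrite /plug linear_sum; apply: eq_bigr => t _; exact: plugU.
Qed.

Lemma braceE s a : brace s a = lin (fun w => multilin (graftsum w) s) a.
Proof. by []. Qed.

Section PlugClosed.
Variables (S : Br -> Prop).
Hypotheses (subS : subspace S) (plugS : plug_closed S).

Lemma subspace_lin_sum (I : eqType) (r : seq I) (h : bword X -> I -> Br) a :
  {in r, forall i, S (lin (h^~ i) a)} ->
  S (lin (fun v => \sum_(i <- r) h v i) a).
Proof. by move=> Sh; rewrite lin_sum; apply: subspace_sum. Qed.

Lemma subspace_linD (h1 h2 : bword X -> Br) a :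
  S (lin h1 a) -> S (lin h2 a) -> S (lin (fun v => h1 v + h2 v) a).
Proof.
move=> S1 S2; rewrite [lin _ _](_ : _ = lin h1 a + lin h2 a).
  exact: subspaceD.
by rewrite -big_split; apply: eq_bigr => w _; rewrite scalerDr.
Qed.

(** In every term of an insertion the marked argument either stays an entry of
    the sequence or is absorbed by a single entry of us; in both cases the term
    is obtained by an operation plug from an element of S.  The prefix s makes
    the induction on us go through. *)
Lemma insert_slot_closed x us a :
  {in us, forall u p q, S (lin (fun v => graftsum u (p ++ v :: q)) a)} ->
  S a -> forall s p q,
  S (lin (fun v => \sum_(t <- insert (@graft X) us (p ++ v :: q))
                     bm (BWord x (s ++ t))) a).
Proof.
move=> Sus Sa; elim: us Sus => [|u us IHus] Sus s p q.
  rewrite (eq_lin (h2 := fun v => bm (BWord x ((s ++ p) ++ v :: q)))).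
    exact: plugS.
  by move=> v _ /=; rewrite big_seq1 catA.
have Su := Sus _ (mem_head u us).
have {}IHus := IHus (fun w w_us => Sus w (mem_behead (s := u :: us) w_us)).
pose H1 c1 c2 := \sum_(Q <- cuts c2) \sum_(t <- graft u Q.1)
  \sum_(r <- insert (@graft X) us Q.2) bm (BWord x (s ++ c1 ++ t :: r)).
rewrite (eq_lin (h2 := fun v => \sum_(c <- cuts p) H1 c.1 (c.2 ++ v :: q) +
   \sum_(c <- cuts q) H1 (p ++ v :: c.1) c.2)); last first.
  by move=> v _; rewrite sum_insert_cons (sum_cuts_cat_cons _ _ _ H1).
apply: subspace_linD; apply: subspace_lin_sum => c _.
  pose H2 d1 d2 := \sum_(t <- graft u d1)
    \sum_(r <- insert (@graft X) us d2) bm (BWord x (s ++ c.1 ++ t :: r)).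
  rewrite (eq_lin (h2 := fun v => \sum_(d <- cuts c.2) H2 d.1 (d.2 ++ v :: q) +
     \sum_(d <- cuts q) H2 (c.2 ++ v :: d.1) d.2)); last first.
    by move=> v _; rewrite /H1 (sum_cuts_cat_cons _ _ _ H2).
  apply: subspace_linD; apply: subspace_lin_sum => d _.
    apply: subspace_lin_sum => t _.
    rewrite (eq_lin (h2 := fun v =>
      \sum_(r <- insert (@graft X) us (d.2 ++ v :: q))
        bm (BWord x ((s ++ c.1 ++ [:: t]) ++ r)))); first exact: IHus.
    by move=> v _; apply: eq_bigr => r _; rewrite -!catA.
  rewrite (eq_lin (h2 := fun v => \sum_(r <- insert (@graft X) us d.2)
     plug x (s ++ c.1) r (graftsum u (c.2 ++ v :: d.1)))); last first.
    move=> v _; rewrite /H2 exchange_big; apply: eq_bigr => r _.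
    by rewrite plug_sum; apply: eq_bigr => t _; rewrite -catA.
  apply: subspace_lin_sum => r _; rewrite -[lin _ _]linear_lin.
  exact/plugS/Su.
apply: subspace_lin_sum => Q _; apply: subspace_lin_sum => t _.
apply: subspace_lin_sum => r _.
rewrite (eq_lin (h2 := fun v => bm (BWord x ((s ++ p) ++ v :: c.1 ++ t :: r)))).
  exact: plugS.
by move=> v _; rewrite -!catA.
Qed.

(** An ideal of the absolutely free structure absorbs grafting of its
    elements; only the argument on which one grafts needs the brace
    identity. *)
Lemma graftsum_slot_closed w p q a :
  S a -> S (lin (fun v => graftsum w (p ++ v :: q)) a).
Proof.
move=> Sa; elim/bword_ind_mem: w p q => x us IH p q.
rewrite (eq_lin (h2 := fun v => \sum_(t <- insert (@graft X) us (p ++ v :: q))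
  bm (BWord x ([::] ++ t)))).
  exact: insert_slot_closed.
by move=> v _; rewrite /graftsum sum_graft_BWord.
Qed.

End PlugClosed.

(** The ideal of the absolutely free structure generated by the relators
    <vs; f>. *)
Definition graft_ideal f a := forall S, subspace S -> plug_closed S ->
  (forall vs, S (lin (graftsum^~ vs) f)) -> S a.

Lemma graft_ideal_subspace f : subspace (graft_ideal f).
Proof.
split=> [|c a b Ia Ib] S subS plS Sf; first exact: subspace0.
by apply: subS.2; [apply: Ia | apply: Ib].
Qed.

Lemma graft_ideal_plug f : plug_closed (graft_ideal f).
Proof. move=> x p q a Ia S subS plS Sf; exact/plS/(Ia S). Qed.

Lemma graft_ideal_gen f vs : graft_ideal f (lin (graftsum^~ vs) f).
Proof. by move=> S _ _; apply. Qed.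

(** Grafting onto a relator gives a sum of relators by the brace identity, and
    grafting onto plug x p q a gives a sum of plugs of grafts onto a. *)
Lemma graft_ideal_graftr f a vs :
  graft_ideal f a -> graft_ideal f (lin (graftsum^~ vs) a).
Proof.
have subI := graft_ideal_subspace f.
move=> Ia; move: vs; apply: (Ia (fun a => forall vs, _)) => {a Ia}.
- split=> [vs|c a b Ia Ib vs]; first by rewrite linear0; apply: subspace0.
  by rewrite linearP; apply: (subI.2 _ _ _ (Ia vs) (Ib vs)).
- move=> x p q a Ia vs; rewrite linear_lin.
  rewrite (eq_lin (h2 := fun v => \sum_(P <- cuts vs) \sum_(Q <- cuts P.2)
    \sum_(s <- insert (@graft X) p P.1) \sum_(r <- insert (@graft X) q Q.2)
    plug x s r (graftsum v Q.1))).
    apply: subspace_lin_sum => // P _; apply: subspace_lin_sum => // Q _.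
    apply: subspace_lin_sum => // s _; apply: subspace_lin_sum => // r _.
    rewrite -[lin _ _]linear_lin.
    apply: graft_ideal_plug; exact: Ia.
  move=> v _; rewrite /= linU /graftsum sum_graft_BWord sum_insert_cat_cons.
  apply: eq_bigr => P _; apply: eq_bigr => Q _; apply: eq_bigr => s _.
  by rewrite exchange_big; apply: eq_bigr => r _; rewrite plug_sum.
- move=> us vs; rewrite linear_lin.
  rewrite (eq_lin (h2 := fun w => \sum_(r <- insert (@graft X) us vs)
    graftsum w r)).
    by apply: subspace_lin_sum => // r _; apply: graft_ideal_gen.
  move=> w _; rewrite /= linear_sum /graftsum -sum_graftA.
  by apply: eq_bigr => t _; rewrite /= linU.
Qed.

Lemma graft_ideal_brace_ideal f : brace_ideal (graft_ideal f).
Proof.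
have subI := graft_ideal_subspace f; split=> // s a [b]; rewrite inE.
case/predU1P=> [-> | sb] Ib; rewrite braceE.
  rewrite multilin_linC; apply: subspace_multilin => // vs _.
  exact: graft_ideal_graftr.
case/splitPr: sb => s1 s2; apply: subspace_lin => // w _.
apply: subspace_multilin_slot => // p q.
exact: (graftsum_slot_closed subI (@graft_ideal_plug f)).
Qed.

Lemma Id_graft_ideal f a : Id f a -> graft_ideal f a.
Proof.
apply; first exact: graft_ideal_brace_ideal.
have := graft_ideal_gen (f := f) [::].
by under eq_lin => w _ do rewrite graftsum0; rewrite lin_bmono.
Qed.

End Ideals.

(** * A well-ordering of words *)

(** Sequences of which one is a prefix of the other are not comparable here.
    This makes the comparison of two sequences independent of what follows
    them as soon as it is decided. *)
Fixpoint lexlt (s t : seq nat) : bool :=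
  match s, t with
  | a :: s', b :: t' => (a < b)%N || (a == b) && lexlt s' t'
  | _, _ => false
  end.

Lemma lexlt_irr s : lexlt s s = false.
Proof. by elim: s => //= a s ->; rewrite ltnn eqxx. Qed.

Lemma lexlt_trans : transitive lexlt.
Proof.
elim=> [|b t IHt] [|a s] [|c r] //=.
case/orP=> [ab | /andP[/eqP-> st]] /orP[bc | /andP[/eqP<- tr]].
- by rewrite (ltn_trans ab bc).
- by rewrite ab.
- by rewrite bc.
- by rewrite eqxx (IHt _ _ st tr) orbT.
Qed.

Lemma lexlt_cat s t a b : size s = size t ->
  lexlt (s ++ a) (t ++ b) = lexlt s t || (s == t) && lexlt a b.
Proof.
elim: s t => [|x s IHs] [|y t] //= [/IHs->].
rewrite eqseq_cons; case: ltngtP => //= _; by rewrite andbF.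
Qed.

Lemma lexlt_total s t : size s = size t -> s != t -> lexlt s t || lexlt t s.
Proof.
elim: s t => [|x s IHs] [|y t] //= [/IHs{}IHs].
by rewrite eqseq_cons; case: ltngtP.
Qed.

(** The lexicographic order is well-founded on sequences of a fixed length,
    without any bound on their entries. *)
Lemma lexlt_size_ind n (P : seq nat -> Prop) :
  (forall s, size s = n ->
     (forall t, size t = n -> lexlt t s -> P t) -> P s) ->
  forall s, size s = n -> P s.
Proof.
elim: n P => [|n IHn] P IH.
  by move=> s s0; apply: IH => // t _; rewrite (size0nil s0); case: t.
suff Pcons a s : size s = n -> P (a :: s).
  by case=> // a s [sn]; apply: Pcons.
elim/ltn_ind: a s => a IHa; apply: IHn => s sn IHs; apply: IH => [|[|b t]] //=.
  by rewrite sn.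
by case=> tn /orP[ba | /andP[/eqP-> ts]]; [apply: IHa | apply: IHs].
Qed.

Section WordOrder.
Variables (X : countType) (z : X).
Implicit Types (u v w : bword X) (us vs ws : seq (bword X)).

Fixpoint weight (h : X -> nat) w : nat :=
  let: BWord x us := w in (h x + sumn (map (weight h) us))%N.

Definition zdeg := weight (fun x => x == z).
Definition wsize := weight (fun=> 1%N).

(** Words are compared through these codes, with lexlt.  Repeating the number
    of letters in front of every subword makes the length of a code readable
    from its head, so no code is a proper prefix of another one. *)
Fixpoint code w : seq nat :=
  let: BWord x us := w in
  [:: zdeg w, wsize w, size us, choice.pickle x & flatten (map code us)].

Definition codes us := flatten (map code us).
Definition wlt u v := lexlt (code u) (code v).
Definition wle u v := (u == v) || wlt u v.
Definition slt us vs := lexlt (codes us) (codes vs).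

Lemma zdegE x us : zdeg (BWord x us) = ((x == z) + sumn (map zdeg us))%N.
Proof. by []. Qed.

Lemma wsizeE x us : wsize (BWord x us) = (sumn (map wsize us)).+1.
Proof. by []. Qed.

Lemma size_code w : size (code w) = (4 * wsize w)%N.
Proof.
elim/bword_ind_mem: w => x us IH; rewrite wsizeE /= -/(codes us).
suff -> : size (codes us) = (4 * sumn (map wsize us))%N by lia.
elim: us IH => [|u us IHus] IH //=.
rewrite -/(codes us) size_cat IHus; last first.
  by move=> v vs; apply: IH; rewrite inE vs orbT.
by rewrite (IH u) ?mem_head // mulnDr.
Qed.

Lemma codeE w : exists c, code w = [:: zdeg w, wsize w & c].
Proof. by case: w => x us; eexists. Qed.

Lemma size_code_eq u v c d :
  code u ++ c = code v ++ d -> size (code u) = size (code v).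
Proof.
rewrite !size_code; have [? ->] := codeE u; have [? ->] := codeE v.
by move=> [_ ->].
Qed.

Lemma code_inj : injective code.
Proof.
move=> u; elim/bword_ind_mem: u => x us IH [y vs] /=.
move=> [_ _ + /(pcan_inj choice.pickleK)->].
rewrite -/(codes us) -/(codes vs) => suv euv; congr BWord; move: suv euv.
elim: us IH vs => [|u us IHus] IH [|v vs] //= [suv] euv.
have suv1 := size_code_eq euv; move/eqP: euv.
rewrite eqseq_cat // => /andP[/eqP euv /eqP eus].
rewrite (IH u (mem_head _ _) v euv); congr (_ :: _); apply: IHus => //.
by move=> w w_us; apply: IH; rewrite inE w_us orbT.
Qed.

(** Codes of different lengths already differ in one of their first two
    entries. *)
Lemma lexlt_code_cat u v a b :
  lexlt (code u ++ a) (code v ++ b) = wlt u v || (u == v) && lexlt a b.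
Proof.
have [eq_size | ne_size] := eqVneq (size (code u)) (size (code v)).
  by rewrite lexlt_cat // (inj_eq code_inj).
have neq_uv : (u == v) = false.
  by apply: contra_neqF ne_size => /eqP->.
have ne_wsize : (wsize u == wsize v) = false.
  by apply: contra_neqF ne_size => /eqP; rewrite !size_code => ->.
rewrite neq_uv orbF /wlt; have [? ->] := codeE u; have [? ->] := codeE v.
by rewrite /= ne_wsize.
Qed.

Lemma slt_cons u v us vs :
  slt (u :: us) (v :: vs) = wlt u v || (u == v) && slt us vs.
Proof. exact: lexlt_code_cat. Qed.

Lemma wlt_irr u : wlt u u = false. Proof. exact: lexlt_irr. Qed.

Lemma wlt_trans : transitive wlt.
Proof. by move=> v u w; apply: lexlt_trans. Qed.

Lemma wle_trans : transitive wle.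
Proof.
move=> v u w /predU1P[-> // | uv] /predU1P[<- | vw]; rewrite /wle ?uv ?orbT //.
by rewrite (wlt_trans uv vw) orbT.
Qed.

Lemma wlt_le_trans u v w : wlt u v -> wle v w -> wlt u w.
Proof. by move=> uv /predU1P[<- | ] //; apply: wlt_trans. Qed.

Lemma wle_refl u : wle u u. Proof. by rewrite /wle eqxx. Qed.

Lemma wltW u v : wlt u v -> wle u v. Proof. by rewrite /wle orbC => ->. Qed.

Lemma wltE u v : wlt u v =
  (zdeg u < zdeg v)%N || (zdeg u == zdeg v) &&
  ((wsize u < wsize v)%N || (wsize u == wsize v) && wlt u v).
Proof.
rewrite /wlt; have [cu ->] := codeE u; have [cv ->] := codeE v => /=.
by case: ltngtP => //= _; case: ltngtP.
Qed.

Lemma wlt_total u v : u != v -> wlt u v || wlt v u.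
Proof.
move=> neq_uv.
have [eq_size | ne_size] := eqVneq (size (code u)) (size (code v)).
  by apply: lexlt_total => //; rewrite (inj_eq code_inj).
rewrite wltE (wltE v); move: ne_size; rewrite !size_code.
rewrite eqn_pmul2l //; case: (ltngtP (zdeg u)); case: (ltngtP (wsize u)) => //.
Qed.

Lemma slt_total us vs :
  size us = size vs -> us != vs -> slt us vs || slt vs us.
Proof.
elim: us vs => [|u us IHus] [|v vs] //= [/IHus{}IHus].
rewrite eqseq_cons negb_and !slt_cons (eq_sym v).
have [-> /= /IHus|neq_uv _] := eqVneq u v; first by rewrite wlt_irr.
by case/orP: (wlt_total neq_uv) => ->; rewrite ?orbT.
Qed.

(** For fixed z-degree and number of letters all codes have the same length. *)
Lemma wlt_wf : well_founded (fun u v => wlt u v).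
Proof.
suff H m n w : zdeg w = m -> wsize w = n -> Acc (fun u v => wlt u v) w.
  by move=> w; apply: H.
elim/ltn_ind: m n w => m IHm; elim/ltn_ind=> n IHn w wm wn.
pose P c := forall w, zdeg w = m -> wsize w = n -> code w = c ->
  Acc (fun u v => wlt u v) w.
suff Pcode c : size c = (4 * n)%N -> P c.
  by apply: (Pcode (code w)); rewrite ?size_code ?wn.
move: c => {w wm wn}; apply: (@lexlt_size_ind _ P) => c _ IHc w wm wn Ec.
constructor=> v; rewrite wltE wm wn => /orP[vm | /andP[/eqP vm]].
  exact: (IHm _ vm (wsize v)).
case/orP=> [vn | /andP[/eqP vn vw]]; first exact: (IHn _ vn).
by apply: (IHc (code v)); rewrite ?size_code ?vn // -Ec.
Qed.

Lemma wlt_BWord x y us vs : wlt (BWord x us) (BWord y vs) =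
  (zdeg (BWord x us) < zdeg (BWord y vs))%N ||
  (zdeg (BWord x us) == zdeg (BWord y vs)) &&
  ((wsize (BWord x us) < wsize (BWord y vs))%N ||
   (wsize (BWord x us) == wsize (BWord y vs)) &&
   ((size us < size vs)%N || (size us == size vs) &&
    ((choice.pickle x < choice.pickle y)%N ||
     (choice.pickle x == choice.pickle y) && slt us vs))).
Proof. by []. Qed.

Lemma sub_weight h us u :
  u \in us -> (weight h u <= sumn (map (weight h) us))%N.
Proof. by case/splitPr=> us1 us2; rewrite map_cat sumn_cat /=; lia. Qed.

Lemma sub_wsize x us u : u \in us -> (wsize u < wsize (BWord x us))%N.
Proof. exact: sub_weight. Qed.

Lemma sub_wlt x us u : u \in us -> wlt u (BWord x us).
Proof.
move=> u_us; have zle : (zdeg u <= zdeg (BWord x us))%N.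
  exact: leq_trans (sub_weight _ u_us) (leq_addl _ _).
by rewrite wltE sub_wsize // andbT orbC -leq_eqVlt.
Qed.

Lemma wle_weights u v : wle u v ->
  (zdeg u <= zdeg v)%N /\ (zdeg u = zdeg v -> (wsize u <= wsize v)%N).
Proof.
by case/predU1P=> [-> // | ]; rewrite wltE; move: (wlt u v) => b; lia.
Qed.

(** The order is compatible with the operations of the absolutely free
    structure. *)
Lemma wle_BWord x us vs :
  all2 wle us vs -> wle (BWord x us) (BWord x vs).
Proof.
move=> le_uv.
have [eq_size zle sle slt_uv] : [/\ size us = size vs,
    (sumn (map zdeg us) <= sumn (map zdeg vs))%N,
    sumn (map zdeg us) = sumn (map zdeg vs) ->
    (sumn (map wsize us) <= sumn (map wsize vs))%N
  & us = vs \/ slt us vs].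
  elim: us vs le_uv => [|u us IHus] [|v vs] //=; first by split=> //; left.
  case/andP=> uv /IHus[-> zle sle slt_uv]; have [zuv suv] := wle_weights uv.
  split=> [//| | |]; [exact: leq_add | by lia |].
  rewrite slt_cons; case/predU1P: uv => [-> | ->]; last by right.
  by rewrite eqxx; case: slt_uv => [-> | ->]; [left | rewrite orbT; right].
case: slt_uv => [-> | slt_uv]; first exact: wle_refl.
apply: wltW; rewrite wlt_BWord eq_size slt_uv !eqxx ltnn !orbT !andbT.
rewrite !zdegE !wsizeE; lia.
Qed.

Definition wmax w s := foldr (fun a m => if wle a m then m else a) w s.

Lemma wmax_mem w s : wmax w s \in w :: s.
Proof.
elim: s => [|a s IHs] /=; rewrite !inE ?eqxx //.
case: ifP => _; last by rewrite eqxx orbT.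
by move: IHs; rewrite inE => /orP[->|->]; rewrite ?orbT.
Qed.

Lemma wle_wmax w s t : t \in w :: s -> wle t (wmax w s).
Proof.
elim: s => [|a s IHs] /=; first by rewrite inE => /eqP->; apply: wle_refl.
have wle_if : wle (wmax w s) (if wle a (wmax w s) then wmax w s else a).
  case: ifPn => [_|]; first exact: wle_refl.
  by rewrite negb_or => /andP[/wlt_total/orP[as_|/wltW]]; rewrite // as_.
rewrite !inE => /or3P[tw | /eqP-> | ts]; last 1 first.
- by apply: wle_trans wle_if; apply: IHs; rewrite inE ts orbT.
- by apply: wle_trans wle_if; apply: IHs; rewrite inE tw.
- by case: ifP => // _; apply: wle_refl.
Qed.

End WordOrder.

(** * Leading terms of grafts *)

Section Leads.
Variables (X : countType) (z : X).
Implicit Types (u v w t : bword X) (us vs ws ts : seq (bword X)).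

Lemma mem_cuts (T : eqType) (s : seq T) p : (p \in cuts s) = (p.1 ++ p.2 == s).
Proof.
apply/mapP/eqP => [[i _ ->] | <-]; first exact: cat_take_drop.
exists (size p.1); first by rewrite mem_iota size_cat /=; lia.
by rewrite take_size_cat // drop_size_cat //; case: p.
Qed.

Lemma insert_consP u us vs ts : reflect
  (exists s W r t, [/\ vs = s ++ W ++ r, t \in graft u W &
     exists2 r', r' \in insert (@graft X) us r & ts = s ++ t :: r'])
  (ts \in insert (@graft X) (u :: us) vs).
Proof.
apply: (iffP flatten_mapP) => [[p] | [s [W [r [t [-> tW [r' r'r ->]]]]]]].
  rewrite mem_cuts => /eqP <- /flatten_mapP[q]; rewrite mem_cuts => /eqP <-.
  case/allpairsP=> [[t r] [tq rq ->]].
  by exists p.1, q.1, q.2, t; split=> //; exists r.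
exists (s, W ++ r); first by rewrite mem_cuts.
apply/flatten_mapP; exists (W, r); first by rewrite mem_cuts.
by apply/allpairsP; exists (t, r').
Qed.

Lemma mem_graft x us vs ts :
  (BWord x ts \in graft (BWord x us) vs) = (ts \in insert (@graft X) us vs).
Proof. by rewrite /= mem_map // => ? ? []. Qed.

Lemma graftP x us vs t :
  reflect (exists2 ts, ts \in insert (@graft X) us vs & t = BWord x ts)
          (t \in graft (BWord x us) vs).
Proof. exact: mapP. Qed.

Lemma size_insert us vs ts :
  ts \in insert (@graft X) us vs -> (size ts <= size us + size vs)%N.
Proof.
elim: us vs ts => [|u us IHus] vs ts; first by rewrite inE => /eqP->.
case/insert_consP=> s [W [r [t [-> _ [r' /IHus r'r ->]]]]].
by rewrite !size_cat /=; lia.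
Qed.

(** All letters are kept by grafting: both the z-degree and the number of
    letters are additive. *)
Lemma weight_graft h w vs t : t \in graft w vs ->
  weight h t = (weight h w + sumn (map (weight h) vs))%N.
Proof.
elim/bword_ind_mem: w vs t => x us IH vs t /graftP[ts ts_us ->] /=.
rewrite -addnA; congr addn.
elim: us vs ts ts_us IH => [|u us IHus] vs ts.
  by rewrite inE => /eqP-> _.
case/insert_consP=> s [W [r [t' [-> t'W [r' r'r ->]]]]] IH.
have := IHus _ _ r'r (fun w w_us => IH w (mem_behead (s := u :: us) w_us)).
have := IH u (mem_head _ _) _ _ t'W.
by rewrite !map_cat !sumn_cat /=; lia.
Qed.

(** The shuffle of us and vs with pattern m, true taking from us; when m ends
    or asks for a missing entry, what remains of us and then of vs follows.
    With this convention every m gives a shuffle, and for sequences of given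
    sizes the pattern is the same whatever their entries. *)
Fixpoint weave (m : bitseq) us vs :=
  match m, us, vs with
  | true :: m', u :: us', _ => u :: weave m' us' vs
  | false :: m', _, v :: vs' => v :: weave m' us vs'
  | _, _, _ => us ++ vs
  end.

Lemma weave_false m us v vs :
  weave (false :: m) us (v :: vs) = v :: weave m us vs.
Proof. by case: us. Qed.

Lemma weave_false_nil m us : weave (false :: m) us [::] = us ++ [::].
Proof. by case: us. Qed.

Lemma insert_cons_in u us vs ts :
  ts \in insert (@graft X) us vs ->
  u :: ts \in insert (@graft X) (u :: us) vs.
Proof.
move=> ts_in; apply/insert_consP; exists [::], [::], vs, u.
by split=> //; [rewrite graft0 inE | exists ts].
Qed.

Lemma insert_in_cons v us vs ts :
  ts \in insert (@graft X) us vs ->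
  v :: ts \in insert (@graft X) us (v :: vs).
Proof.
case: us => [|u us]; first by rewrite !inE => /eqP->.
case/insert_consP=> s [W [r [t [-> tW [r' r'r ->]]]]].
by apply/insert_consP; exists (v :: s), W, r, t; split=> //; exists r'.
Qed.

Lemma cat_in_insert us vs : us ++ vs \in insert (@graft X) us vs.
Proof.
by elim: us => [|u us IHus]; [rewrite inE | apply: insert_cons_in].
Qed.

Lemma weave_in_insert m us vs : weave m us vs \in insert (@graft X) us vs.
Proof.
elim: m us vs => [|[] m IHm] us vs; first exact: cat_in_insert.
  by case: us => [|u us]; [apply: cat_in_insert | apply: insert_cons_in].
case: vs => [|v vs]; first by rewrite weave_false_nil cat_in_insert.
by rewrite weave_false; apply: insert_in_cons.
Qed.

(** The longest terms of an insertion are those in which every entry of us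
    absorbs the empty interval, that is, shuffles. *)
Lemma insert_weave us vs ts :
  ts \in insert (@graft X) us vs -> size ts = (size us + size vs)%N ->
  exists m, ts = weave m us vs.
Proof.
elim: us vs ts => [|u us IHus] vs ts.
  by rewrite inE => /eqP-> _; exists [::].
case/insert_consP=> s [W [r [t [-> tW [r' r'r ->]]]]].
have := size_insert r'r; rewrite !size_cat /= => le_r' eq_size.
case: W => [|v W] /= in tW eq_size *; last by lia.
rewrite graft0 inE in tW; rewrite (eqP tW).
have [m ->] : exists m, r' = weave m us r by apply: IHus => //; lia.
exists (nseq (size s) false ++ true :: m).
by elim: s {eq_size} => //= v s <-.
Qed.

Lemma size_weave m us vs : size (weave m us vs) = (size us + size vs)%N.
Proof.
elim: m us vs => [|[] m IHm] [|u us] [|v vs] //=; rewrite ?size_cat ?IHm //=.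
by rewrite addnS.
Qed.

Lemma mem_weave m us vs v :
  v \in weave m us vs -> (v \in us) || (v \in vs).
Proof.
elim: m us vs => [|[] m IHm] us vs; first by rewrite mem_cat.
  case: us => [|u us] /=; first by move=> ->.
  by rewrite !inE => /predU1P[-> | /IHm/orP[-> | ->]]; rewrite ?eqxx ?orbT.
case: vs => [|w vs]; first by rewrite weave_false_nil cats0 => ->.
rewrite weave_false !inE => /predU1P[-> | /IHm/orP[-> | ->]] //;
  by rewrite ?eqxx ?orbT.
Qed.

Lemma slt_catl us us' vs vs' : size us = size us' -> slt z us us' ->
  slt z (us ++ vs) (us' ++ vs').
Proof.
elim: us us' => [|u us IHus] [|u' us'] //= [/IHus{}IHus].
rewrite !slt_cons => /orP[-> // | /andP[/eqP-> /IHus->]].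
by rewrite eqxx orbT.
Qed.

Lemma slt_catr us vs vs' : slt z vs vs' -> slt z (us ++ vs) (us ++ vs').
Proof.
by move=> lt_vs; elim: us => //= u us; rewrite slt_cons eqxx orbC => ->.
Qed.

(** With a fixed pattern, a shuffle increases strictly with each of its two
    components, by comparison at the first position where they differ. *)
Lemma weave_sltl m us us' vs : size us = size us' ->
  slt z us us' -> slt z (weave m us vs) (weave m us' vs).
Proof.
elim: m us us' vs => [|[] m IHm] us us' vs; first exact: slt_catl.
  case: us us' => [|u us] [|u' us'] //= [/IHm{}IHm].
  rewrite !slt_cons => /orP[-> // | /andP[-> /IHm->]].
  by rewrite orbT.
case: vs => [|v vs] eq_size lt_us.
  by rewrite !weave_false_nil slt_catl.
by rewrite !weave_false slt_cons eqxx (IHm _ _ _ eq_size lt_us) orbT.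
Qed.

Lemma weave_sltr m us vs vs' : size vs = size vs' ->
  slt z vs vs' -> slt z (weave m us vs) (weave m us vs').
Proof.
elim: m us vs vs' => [|[] m IHm] us vs vs'; first by move=> _; apply: slt_catr.
  case: us => [|u us] eq_size lt_vs; first exact: lt_vs.
  by rewrite /= slt_cons eqxx (IHm _ _ _ eq_size lt_vs) orbT.
case: vs vs' => [|v vs] [|v' vs'] // [/(IHm us){}IHm].
rewrite !weave_false !slt_cons => /orP[-> // | /andP[-> /IHm->]].
by rewrite orbT.
Qed.

(** The starting value of the maximum is itself a term of the graft. *)
Definition lead w vs :=
  let: BWord x us := w in wmax z (BWord x (us ++ vs)) (graft w vs).

Lemma lead_mem w vs : lead w vs \in graft w vs.
Proof.
case: w => x us.
have : lead (BWord x us) vs \in BWord x (us ++ vs) :: graft (BWord x us) vs.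
  exact: wmax_mem.
by rewrite inE => /predU1P[-> | //]; rewrite mem_graft cat_in_insert.
Qed.

Lemma wle_lead w vs t : t \in graft w vs -> wle z t (lead w vs).
Proof. by case: w => x us tw; apply: wle_wmax; rewrite inE tw orbT. Qed.

Lemma wlt_same_weights x y us ts :
  zdeg z (BWord x us) = zdeg z (BWord y ts) ->
  wsize (BWord x us) = wsize (BWord y ts) ->
  wlt z (BWord x us) (BWord y ts) =
  (size us < size ts)%N || (size us == size ts) &&
    ((choice.pickle x < choice.pickle y)%N ||
     (choice.pickle x == choice.pickle y) && slt z us ts).
Proof. by move=> eq_z eq_s; rewrite wlt_BWord eq_z eq_s !eqxx !ltnn. Qed.

(** A term of the graft with fewer root arguments is smaller than the one
    obtained by attaching vs to the root after us. *)
Lemma lead_weave x us vs :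
  exists m, lead (BWord x us) vs = BWord x (weave m us vs).
Proof.
have /graftP[ts ts_in lead_ts] := lead_mem (BWord x us) vs.
have [eq_size | ne_size] := eqVneq (size ts) (size us + size vs)%N.
  have [m def_ts] := insert_weave ts_in eq_size.
  by exists m; rewrite lead_ts def_ts.
have cat_in : BWord x (us ++ vs) \in graft (BWord x us) vs.
  by rewrite mem_graft cat_in_insert.
have := wle_lead cat_in; rewrite lead_ts.
have {}ts_in' : BWord x ts \in graft (BWord x us) vs by rewrite mem_graft.
have lt_ts : wlt z (BWord x ts) (BWord x (us ++ vs)).
  rewrite wlt_same_weights /zdeg /wsize ?(weight_graft _ cat_in) //;
    rewrite ?(weight_graft _ ts_in') //.
  by rewrite size_cat ltn_neqAle ne_size (size_insert ts_in).
by move/(wlt_le_trans lt_ts); rewrite wlt_irr.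
Qed.

(** If vs precedes vs', the shuffle for vs' with the pattern of the leading
    word for vs is larger than that leading word. *)
Lemma lead_inj w : injective (lead w).
Proof.
case: w => x us vs vs' eq_lead.
have [m lead_m] := lead_weave x us vs; have [m' lead_m'] := lead_weave x us vs'.
have eq_size : size vs = size vs'.
  move: eq_lead; rewrite lead_m lead_m' => -[] /(congr1 size).
  by rewrite !size_weave => /addnI.
have [// | neq_vs] := eqVneq vs vs'.
wlog lt_vs : vs vs' m m' eq_lead lead_m lead_m' eq_size neq_vs / slt z vs vs'.
  move=> IH; case/orP: (slt_total z eq_size neq_vs) => lt_vs.
    exact: IH lead_m lead_m' eq_size neq_vs lt_vs.
  by rewrite [RHS](IH _ _ _ _ (esym eq_lead) lead_m' lead_m) // eq_sym.
have t_in : BWord x (weave m us vs') \in graft (BWord x us) vs'.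
  by rewrite mem_graft weave_in_insert.
have lead_in := lead_mem (BWord x us) vs'.
have := wle_lead t_in; rewrite -eq_lead lead_m in lead_in *.
suff lt_t : wlt z (BWord x (weave m us vs)) (BWord x (weave m us vs')).
  by move/(wlt_le_trans lt_t); rewrite wlt_irr.
rewrite wlt_same_weights /zdeg /wsize ?(weight_graft _ t_in) //;
    rewrite ?(weight_graft _ lead_in) //.
by rewrite !size_weave eq_size !eqxx weave_sltr ?orbT.
Qed.

(** Leading words of grafts increase with the word on which one grafts.  When
    w' and w differ before the root arguments are compared, attaching all of
    vs to the root of w after its arguments gives a larger word; otherwise a
    shuffle for w' is dominated by the shuffle for w with the same pattern. *)
Lemma lead_lt w' w vs t :
  wlt z w' w -> t \in graft w' vs -> wlt z t (lead w vs).
Proof.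
case: w' w => [x' us'] [x us] lt_w t_in.
suff [t' t'_in lt_t] : exists2 t', t' \in graft (BWord x us) vs & wlt z t t'.
  exact: wlt_le_trans lt_t (wle_lead t'_in).
have cat_in : BWord x (us ++ vs) \in graft (BWord x us) vs.
  by rewrite mem_graft cat_in_insert.
have /graftP[ts ts_in def_t] := t_in; have size_ts := size_insert ts_in.
move: lt_w; rewrite wlt_BWord => /orP[lt_z | /andP[/eqP eq_z /orP[lt_s |]]].
- exists (BWord x (us ++ vs)) => //; rewrite wltE.
  rewrite /zdeg (weight_graft _ t_in) (weight_graft _ cat_in) ltn_add2r.
  by rewrite [(_ < _)%N]lt_z.
- exists (BWord x (us ++ vs)) => //.
  have eq_z' : zdeg z t = zdeg z (BWord x (us ++ vs)).
    by rewrite /zdeg (weight_graft _ t_in) (weight_graft _ cat_in); congr addn.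
  have lt_s' : (wsize t < wsize (BWord x (us ++ vs)))%N.
    by rewrite /wsize (weight_graft _ t_in) (weight_graft _ cat_in) ltn_add2r.
  by rewrite wltE eq_z' lt_s' eqxx orbT.
case/andP=> /eqP eq_s lt_root.
have cmp ts' : BWord x ts' \in graft (BWord x us) vs -> wlt z t (BWord x ts') =
  (size ts < size ts')%N || (size ts == size ts') &&
    ((choice.pickle x' < choice.pickle x)%N ||
     (choice.pickle x' == choice.pickle x) && slt z ts ts').
  move=> t'_in; rewrite def_t in t_in *.
  by rewrite wlt_same_weights // /zdeg /wsize (weight_graft _ t_in)
    (weight_graft _ t'_in); congr addn.
have catP : (size ts < size us + size vs)%N \/ size ts = (size us + size vs)%N
  /\ (choice.pickle x' < choice.pickle x)%N ->
  exists2 t', t' \in graft (BWord x us) vs & wlt z t t'.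
  move=> lt_cat; exists (BWord x (us ++ vs)) => //; rewrite cmp // size_cat.
  by case: lt_cat => [-> // | [-> ->]]; rewrite eqxx orbT.
have [eq_size | ne_size] := eqVneq (size ts) (size us' + size vs)%N; last first.
  apply: catP; left; have lt_ts : (size ts < size us' + size vs)%N.
    by rewrite ltn_neqAle ne_size.
  apply: leq_trans lt_ts _; rewrite leq_add2r.
  by case/orP: lt_root => [/ltnW | /andP[/eqP->]].
case/orP: lt_root => [lt_size | /andP[/eqP eq_us]].
  by apply: catP; left; rewrite eq_size ltn_add2r.
case/orP=> [lt_x | /andP[eq_x lt_us]].
  by apply: catP; right; rewrite eq_size eq_us.
have [m def_ts] := insert_weave ts_in eq_size.
exists (BWord x (weave m us vs)); first by rewrite mem_graft weave_in_insert.
rewrite cmp ?mem_graft ?weave_in_insert // def_ts !size_weave eq_us eqxx eq_x.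
by rewrite weave_sltl ?orbT.
Qed.

End Leads.

(** * Normal forms modulo the ideal of an element *)

Section NormalForm.
Variables (F : fieldType) (X : countType) (z : X).
Hypothesis charF : [pchar F] =i pred0.
Local Notation Br := (Br F X).
Local Notation bm := (@bmono F X).
Implicit Types (a b : Br) (u v w t : bword X) (us vs p q : seq (bword X)).

Definition supported (P : bword X -> Prop) a := forall v, v \in msupp a -> P v.

Lemma supported_subspace P : subspace (supported P).
Proof.
split=> [v|c a b Pa Pb v]; first by rewrite msupp0.
rewrite -mcoeff_neq0 mcoeffD mcoeffZ.
have [/Pa // | /mcoeff_outdom->] := boolP (v \in msupp a).
by rewrite mulr0 add0r mcoeff_neq0 => /Pb.
Qed.

Lemma mem_msupp_bm v w : (v \in msupp (bm w)) = (v == w).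
Proof.
rewrite -mcoeff_neq0 mcoeffU [RHS]eq_sym.
by case: (w == v); rewrite ?mulr1n ?mulr0n ?oner_neq0 ?eqxx.
Qed.

Lemma mcoeff_graftsum w vs v :
  (graftsum F w vs)@_v = (count_mem v (graft w vs))%:R.
Proof.
rewrite raddf_sum /=.
elim: (graft w vs) => [|t s IHs]; first by rewrite big_nil.
by rewrite big_cons IHs mcoeffU /= natrD; case: eqP.
Qed.

Variables (f : Br) (T : bword X).
Hypotheses (fT : T \in msupp f) (maxT : {in msupp f, forall w, wle z w T}).
Hypothesis zT : (0 < zdeg z T)%N.

Local Notation lead := (lead z T).

Definition relator vs : Br := lin ((@graftsum F X)^~ vs) f.

Lemma relator_supp vs : supported (fun v => wle z v (lead vs)) (relator vs).
Proof.
apply: (subspace_lin (supported_subspace _)) => w fw.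
apply: (subspace_sum (supported_subspace _)) => t wt v.
rewrite mem_msupp_bm => /eqP->.
have /predU1P[eq_w | lt_w] := maxT fw.
  by apply: wle_lead; rewrite -eq_w.
exact/wltW/(lead_lt lt_w).
Qed.

(** Only T contributes to this coefficient, with the number of occurrences of
    the leading word in the graft, a positive integer. *)
Lemma relator_lead_neq0 vs : (relator vs)@_(lead vs) != 0.
Proof.
rewrite /relator /lin raddf_sum /= (big_fsetD1 T) //= big1_fset => [|w].
  rewrite addr0 mcoeffZ mulf_eq0 negb_or mcoeff_neq0 fT mcoeff_graftsum.
  by rewrite ((pcharf0P F).1 charF) -lt0n -has_count has_pred1 lead_mem.
rewrite in_fsetD1 => /andP[neq_w fw] _; rewrite mcoeffZ mcoeff_graftsum.
have lt_w : wlt z w T by move: (maxT fw); rewrite /wle (negPf neq_w).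
rewrite (count_memPn _) ?mulr0 //; apply/negP => /(lead_lt lt_w).
by rewrite wlt_irr.
Qed.

(** What the leading word of a relator is rewritten to. *)
Definition tail vs : Br :=
  bm (lead vs) - ((relator vs)@_(lead vs))^-1 *: relator vs.

Lemma tail_supp vs : supported (fun v => wlt z v (lead vs)) (tail vs).
Proof.
move=> v.
have [-> | neq_v] := eqVneq v (lead vs).
  rewrite -mcoeff_neq0 mcoeffB mcoeffZ mcoeffUU mulVf ?subrr ?eqxx //.
  exact: relator_lead_neq0.
rewrite -mcoeff_neq0 mcoeffB mcoeffZ [(bm _)@__]mcoeffU.
rewrite [_ == v]eq_sym (negPf neq_v) mulr0n sub0r oppr_eq0 mulf_eq0 negb_or.
case/andP=> _.
by rewrite mcoeff_neq0 => /relator_supp; rewrite /wle (negPf neq_v).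
Qed.

Definition reducible t := exists vs, lead vs = t.

(** Rewrites t once if it is a leading word, evaluating the smaller words so
    obtained with k. *)
Definition step (k : bword X -> Br) t : Br :=
  if excluded_middle_informative (reducible t) is left red_t then
    lin k (tail (proj1_sig (constructive_indefinite_description _ red_t)))
  else bm t.

Lemma step_lead k vs : step k (lead vs) = lin k (tail vs).
Proof.
rewrite /step; case: excluded_middle_informative => [red_t | []].
2: by exists vs.
by case: constructive_indefinite_description => vs' /= /lead_inj->.
Qed.

Lemma step_irreducible k t : ~ reducible t -> step k t = bm t.
Proof. by rewrite /step; case: excluded_middle_informative. Qed.

Lemma eq_step k1 k2 t :
  (forall v, wlt z v t -> k1 v = k2 v) -> step k1 t = step k2 t.
Proof.
move=> eqk; have [[vs def_t] | irr_t] := classic (reducible t).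
  rewrite -def_t !step_lead; apply: eq_lin => v /tail_supp.
  by rewrite def_t => /eqk.
by rewrite !step_irreducible.
Qed.

(** First normalise the arguments, then rewrite at the root. *)
Definition nf_body (k : bword X -> Br) w : Br :=
  let: BWord x us := w in
  multilin (fun vs => step k (BWord x vs)) (map k us).

Lemma eq_nf_body k1 k2 w : k1 =1 k2 -> nf_body k1 w = nf_body k2 w.
Proof.
move=> eqk; case: w => x us /=; rewrite (eq_map eqk).
by apply: eq_multilin => vs _; apply: eq_step => v _.
Qed.

(** The value of nf_body at w only involves values at smaller words, as nfE
    shows afterwards; the test gives the recursion this guarantee beforehand. *)
Definition nf : bword X -> Br :=
  Fix (@wlt_wf X z) (fun=> Br) (fun w rec =>
    nf_body (fun v => if Bool.bool_dec (wlt z v w) true is left lt_vw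
                      then rec v lt_vw else 0) w).

Lemma nf_unfold w : nf w = nf_body (fun v => if wlt z v w then nf v else 0) w.
Proof.
rewrite /nf Fix_eq -/nf => [|{}w r1 r2 eqr]; apply: eq_nf_body => v.
  by case: Bool.bool_dec => [-> | /negP/negPf->].
by case: Bool.bool_dec.
Qed.

(** No subword is the leading word of a relator. *)
Inductive normal : bword X -> Prop :=
  Normal x us of (forall u, u \in us -> normal u) & ~ reducible (BWord x us) :
    normal (BWord x us).

Definition nf_spec w := supported (fun v => wle z v w /\ normal v) (nf w).

Lemma supp_map_nf us vs : (forall u, u \in us -> nf_spec u) ->
  all2 (fun v a => v \in msupp a) vs (map nf us) ->
  all2 (wle z) vs us /\ (forall v, v \in vs -> normal v).
Proof.
elim: us vs => [|u us IHus] [|v vs] //= spec /andP[/spec[|vu nv]].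
  exact: mem_head.
case/IHus=> [w w_us | le_vs norm_vs].
  by apply: spec; rewrite inE w_us orbT.
by rewrite vu le_vs; split=> // w /predU1P[-> | /norm_vs].
Qed.

Lemma nfE_of_spec w : (forall v, wlt z v w -> nf_spec v) -> nf w = nf_body nf w.
Proof.
case: w => x us spec; rewrite nf_unfold /=.
rewrite (eq_in_map _ nf us).1; last by move=> u /(sub_wlt z x)->.
apply: eq_multilin => vs /supp_map_nf[u /(sub_wlt z x)/spec // | le_vs _].
apply: eq_step => v lt_v.
by rewrite (wlt_le_trans lt_v (wle_BWord x le_vs)).
Qed.

Lemma nfP w : nf_spec w.
Proof.
elim/(well_founded_ind (@wlt_wf X z)): w => w IHw.
rewrite /nf_spec.
rewrite nfE_of_spec //; case: w IHw => x us IHw.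
apply: (subspace_multilin (supported_subspace _)) => vs.
case/supp_map_nf=> [u /(sub_wlt z x)/IHw // | /(wle_BWord x) le_vs norm_vs].
have [[c def_t] | irr_t] := classic (reducible (BWord x vs)); last first.
  rewrite step_irreducible // => v; rewrite mem_msupp_bm => /eqP->.
  by split=> //; apply: Normal.
rewrite -def_t step_lead.
apply: (subspace_lin (supported_subspace _)) => u /tail_supp.
rewrite def_t => lt_u v.
have lt_u_us := wlt_le_trans lt_u le_vs.
case/IHw=> // le_vu norm_v; split=> //; apply: wle_trans le_vu _.
exact: wltW.
Qed.

Lemma nfE x us :
  nf (BWord x us) = multilin (fun vs => step nf (BWord x vs)) (map nf us).
Proof. by rewrite nfE_of_spec // => v _; apply: nfP. Qed.

Lemma nf_normal w : normal w -> nf w = bm w.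
Proof.
elim=> x us _ IHus irr; rewrite nfE (eq_in_map _ bm us).1 //.
by rewrite multilin_bmono step_irreducible.
Qed.

Lemma lin_nf_id a : supported normal a -> lin nf a = a.
Proof.
by move=> norm_a; rewrite -[RHS]lin_bmono; apply: eq_lin => v /norm_a/nf_normal.
Qed.

Definition nf_kernel a := lin nf a = 0.

Lemma nf_kernel_subspace : subspace nf_kernel.
Proof.
split=> [|c a b a0 b0]; first exact: linear0.
by rewrite /nf_kernel linearP /= a0 b0 scaler0 addr0.
Qed.

(** The normal form of <us; x> depends on the arguments only through their
    normal forms, and multilinearly. *)
Lemma nf_kernel_plug : plug_closed nf_kernel.
Proof.
move=> x p q a a0; rewrite /nf_kernel linear_lin.
pose k us := step nf (BWord x us).
rewrite (eq_lin (h2 := fun v => multilin k (map nf p ++ nf v :: map nf q))).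
  rewrite multilin_slot [X in _ ++ X :: _]a0.
  rewrite -[X in _ ++ X :: _](linear0 (lin nf)).
  by rewrite -multilin_slot linear0.
by move=> v _ /=; rewrite linU nfE map_cat.
Qed.

Lemma small_normal w : (wsize w < wsize T)%N -> normal w.
Proof.
elim/bword_ind_mem: w => x us IH ltT; apply: Normal => [u u_us | [vs eq_w]].
  apply: IH => //; apply: leq_ltn_trans ltT.
  exact: ltnW (sub_wsize x u_us).
move: ltT; rewrite -eq_w /wsize (weight_graft _ (lead_mem z T vs)).
by rewrite ltnNge leq_addr.
Qed.

Lemma zfree_normal w : zdeg z w = 0%N -> normal w.
Proof.
elim/bword_ind_mem: w => x us IH w0; apply: Normal => [u u_us | [vs eq_w]].
  apply: IH => //; have [] := wle_weights (wltW (sub_wlt z x u_us)).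
  by rewrite w0 leqn0 => /eqP.
move: w0; rewrite -eq_w /zdeg (weight_graft _ (lead_mem z T vs)) => /eqP.
by rewrite addn_eq0 => /andP[/eqP T0]; move: zT; rewrite /zdeg T0.
Qed.

(** The arguments at the root of the leading word of e_vs come from vs or from
    T, so they are normal and this word is rewritten at its root, by the tail
    of e_vs itself thanks to the injectivity of lead. *)
Lemma relator_normal_kernel vs :
  (forall v, v \in vs -> normal v) -> nf_kernel (relator vs).
Proof.
move=> norm_vs.
have nf_lead : nf (lead vs) = lin nf (tail vs).
  rewrite -step_lead; have [x [us def_T]] : exists x us, T = BWord x us.
    by case: (T) => x us; exists x, us.
  have [m lead_m] := lead_weave z x us vs.
  rewrite def_T lead_m nfE (eq_in_map _ bm _).1.
    by rewrite multilin_bmono.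
  move=> u /mem_weave/orP[u_us | /norm_vs]; last exact: nf_normal.
  by apply/nf_normal/small_normal; rewrite def_T; apply: sub_wsize.
move: nf_lead; rewrite /tail linearB linearZ /= linU => /eqP.
rewrite eq_sym -subr_eq0 addrAC subrr sub0r oppr_eq0 scaler_eq0 invr_eq0.
by rewrite (negPf (relator_lead_neq0 vs)) => /eqP.
Qed.

(** The arguments are replaced one after the other by their normal forms: the
    difference of a word and its normal form lies in the kernel, which absorbs
    grafting of its elements. *)
Lemma relator_kernel vs : nf_kernel (relator vs).
Proof.
rewrite -[vs]cat0s.
have: forall v, v \in [::] -> normal v by [].
elim: vs [::] => [|v vs IHvs] p norm_p.
  by rewrite cats0; apply: relator_normal_kernel.
have slot a : nf_kernel a ->
    nf_kernel (lin (fun u => relator (p ++ u :: vs)) a).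
  move=> a0; rewrite lin_exchange.
  apply: (subspace_lin nf_kernel_subspace) => w _.
  exact: (graftsum_slot_closed nf_kernel_subspace nf_kernel_plug).
have: nf_kernel (bm v - nf v).
  rewrite /nf_kernel linearB /= linU lin_nf_id ?subrr // => u.
  by case/nfP.
move/slot; rewrite /nf_kernel !linearB /= linU => /eqP.
rewrite subr_eq0 => /eqP->.
apply: (subspace_lin nf_kernel_subspace) => u /nfP[_ norm_u].
rewrite -cat_rcons; apply: IHvs => w; rewrite mem_rcons inE.
by case/predU1P=> [-> | /norm_p].
Qed.

Lemma Id_zfree_eq0 g :
  Id f g -> supported (fun v => zdeg z v = 0%N) g -> g = 0.
Proof.
move=> /Id_graft_ideal Ig g_zfree; rewrite -[g]lin_nf_id.
  apply: (Ig nf_kernel); [exact: nf_kernel_subspace | exact: nf_kernel_plug |].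
  exact: relator_kernel.
by move=> v /g_zfree/zfree_normal.
Qed.

End NormalForm.

(** * The Freiheitssatz *)

Section Subalgebra.
Variables (F : fieldType) (X : countType) (z : X) (G : Br F X -> Prop).
Implicit Types (a : Br F X) (w : bword X).

Lemma subalgebra_zfree a :
  (forall g, G g -> supported (fun w => zdeg z w = 0%N) g) ->
  subalgebra_gen G a -> supported (fun w => zdeg z w = 0%N) a.
Proof.
move=> zfreeG gen_a; apply: (gen_a (supported (fun w => zdeg z w = 0%N))) => //.
split=> [|s b zfree]; first exact: supported_subspace.
rewrite braceE.
apply: (subspace_lin (@supported_subspace F X _)) => w bw.
apply: (subspace_multilin (@supported_subspace F X _)) => vs svs.
apply: (subspace_sum (@supported_subspace F X _)) => t wt v.
rewrite mem_msupp_bm => /eqP->; rewrite /zdeg (weight_graft _ wt).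
rewrite [weight _ w](zfree b (mem_head _ _) w bw) add0n {wt bw}.
have {}zfree c : c \in s -> supported (fun w => zdeg z w = 0%N) c.
  by move=> sc; apply: zfree; rewrite inE sc orbT.
elim: s vs svs zfree => [|c s IHs] [|u us] //= /andP[cu /IHs{}IHs] zfree.
rewrite [weight _ u](zfree c (mem_head _ _) u cu) IHs // => d sd.
by apply: zfree; rewrite inE sd orbT.
Qed.

(** A word is the brace of its arguments applied to its root letter. *)
Lemma zfree_subalgebra a : (forall x, x != z -> G (bletter F x)) ->
  supported (fun w => zdeg z w = 0%N) a -> subalgebra_gen G a.
Proof.
move=> letterG zfree S [subS braceS] GS; rewrite -[a]lin_bmono.
apply: (subspace_lin subS) => w /zfree.
elim/bword_ind_mem: w => x us IH; rewrite zdegE => /eqP.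
rewrite addn_eq0 eqb0 => /andP[/letterG/GS Sx /eqP us0].
have -> : bmono F (BWord x us) = brace (map (@bmono F X) us) (bletter F x).
  by rewrite braceE linU multilin_bmono /graftsum /= big_seq1.
apply: braceS => b; rewrite inE => /predU1P[-> // | /mapP[u u_us ->]].
apply: IH => //; apply/eqP; rewrite -leqn0 -us0; exact: sub_weight.
Qed.

End Subalgebra.

(* The letter x_(i+1) is [bletter F i] for i : 'I_M, so the letters
   x_1, .., x_(M-1) are those with i.+1 < M. *)
Theorem theorem3p8 (F : fieldType) (hF : [pchar F] =i pred0)
    (M : nat) (hM : (0 < M)%N) (f : Br F 'I_M) :
  let B' : Br F 'I_M -> Prop :=
    subalgebra_gen (fun g => exists2 i : 'I_M, (i.+1 < M)%N & g = bletter F i) in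
  ~ B' f ->
  forall g : Br F 'I_M, Id f g /\ B' g <-> g = 0.
Proof.
move=> B' notB'f g; split=> [[Ig B'g] | ->]; last first.
  split; first by move=> I [[]].
  by move=> S [[]].
have ltM : (M.-1 < M)%N by rewrite prednK.
pose z := Ordinal ltM.
have neq_z (i : 'I_M) : (i != z) = (i.+1 < M)%N.
  by rewrite -val_eqE /=; have := ltn_ord i; lia.
have g_zfree : supported (fun w => zdeg z w = 0%N) g.
  apply: subalgebra_zfree B'g => _ [i lt_i ->] w.
  rewrite mem_msupp_bm => /eqP->.
  by rewrite zdegE [sumn _]/= addn0; apply/eqP; rewrite eqb0 neq_z.
have [v fv vz] : exists2 v, v \in msupp f & zdeg z v != 0%N.
  apply/hasP; apply/negPn/negP => /hasPn f_zfree; apply: notB'f.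
  apply: (zfree_subalgebra (z := z)) => [i | w /f_zfree].
    by rewrite neq_z => lt_i; exists i.
  by rewrite negbK => /eqP.
(* The maximum is taken over the support; v only serves as a starting value. *)
pose T := wmax z v (msupp f).
have fT : T \in msupp f.
  by have /predU1P[-> | ] : T \in v :: msupp f by apply: wmax_mem.
have maxT : {in msupp f, forall w, wle z w T}.
  by move=> w fw; apply: wle_wmax; rewrite inE fw orbT.
have zT : (0 < zdeg z T)%N.
  have [le_vT _] := wle_weights (maxT v fv).
  by apply: leq_trans le_vT; rewrite lt0n.
exact: (Id_zfree_eq0 hF fT maxT zT).
Qed.
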